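(* Let $(G;X)$ be a polar space. The universal covering of $X$ is a polar covering.
   Context: A polar space is a couple $(G;X)$ of a Lie group $G$ acting continuously and faithfully on a Hausdorff, connected, locally path-connected, semi-locally simply connected space $X$ such that: (1) $Q:=X/G$ is simply connected; (2) the quotient map $X\to Q$ admits a continuous section $x$; (3) the map $G\times Q\to X$, $(g;q)\mapsto g\cdot x(q)$, is a quotient map. For a connected covering $p_{X'}:X'\to X$, let $G'$ be the group of homeomorphisms $g'$ of $X'$ for which there exists $g\in G$ with $p_{X'}\circ g'=g\circ p_{X'}$; such a $g$ is unique and $p_{G'}:G'\to G$ is the group morphism $g'\mapsto g$. The covering $X'$ is called polar if it is connected, Galois, and $p_{G'}$ is surjective. *)

(* Defs.v *)
From HB Require Import structures.
From mathcomp Require Import all_boot all_order all_algebra.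
From mathcomp Require Import all_classical all_reals all_analysis.
From mathcomp Require Import generic_quotient homotopy.
Import Order.TTheory GRing.Theory Num.Theory.
Import numFieldNormedType.Exports.

Set Implicit Arguments.
Unset Strict Implicit.
Unset Printing Implicit Defensive.

Local Open Scope classical_set_scope.
Local Open Scope ring_scope.

Definition unit_interval (R : realType) : Type := set_type `[0 : R, 1].

HB.instance Definition _ (R : realType) :=
  Topological.copy (unit_interval R) (set_type `[0 : R, 1]).

Lemma zero_in_itv (R : realType) : (0 : R) \in `[0 : R, 1]%classic.
Proof. by rewrite inE /= in_itv /= lexx ler01. Qed.

Lemma one_in_itv (R : realType) : (1 : R) \in `[0 : R, 1]%classic.
Proof. by rewrite inE /= in_itv /= lexx ler01. Qed.

Lemma itv_zero_neq_one (R : realType) :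
  (SigSub (zero_in_itv R) : unit_interval R) != SigSub (one_in_itv R).
Proof.
by apply/eqP => /(congr1 val) /= /eqP; rewrite eq_sym oner_eq0.
Qed.

HB.instance Definition _ (R : realType) :=
  isBiPointed.Build (unit_interval R) (@itv_zero_neq_one R).

Section spaces.
Variable R : realType.
Local Notation I := (unit_interval R).

Definition path_homotopic (T : topologicalType) (x y : T)
    (p q : {path I from x to y}) : Prop :=
  exists H : I * I -> T,
    [/\ continuous H,
        forall s, H (s, zero) = p s,
        forall s, H (s, one) = q s,
        forall t, H (zero, t) = x &
        forall t, H (one, t) = y].

Definition path_connected (T : topologicalType) (A : set T) : Prop :=
  A !=set0 /\
  forall x y, A x -> A y ->
    exists p : {path I from x to y in T}, forall s, A (p s).

Definition simply_connected (T : topologicalType) : Prop :=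
  path_connected [set: T] /\
  forall (x : T) (p : {path I from x to x}), path_homotopic p (cst x).

Definition locally_path_connected (T : topologicalType) : Prop :=
  forall (x : T) (U : set T), nbhs x U ->
    exists V : set T, [/\ open V, V x, V `<=` U & path_connected V].

Definition semilocally_simply_connected (T : topologicalType) : Prop :=
  forall x : T, exists2 U : set T, nbhs x U &
    forall p : {path I from x to x}, (forall s, U (p s)) ->
      path_homotopic p (cst x).

End spaces.

(* [connected] holds of the empty set; a connected space is nonempty. *)
Definition connected_space (T : topologicalType) : Prop :=
  [set: T] !=set0 /\ connected [set: T].

Definition quotient_map (S T : topologicalType) (f : S -> T) : Prop :=
  [/\ continuous f, set_surj setT setT f &
      forall U : set T, open (f @^-1` U) -> open U].

Definition homeomorphism (S T : topologicalType) (f : S -> T) : Prop :=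
  continuous f /\
  exists g : T -> S, [/\ continuous g, cancel f g & cancel g f].

#[short(type="preTopGroupType")]
HB.structure Definition PreTopGroup := {G of Topological G & Group G}.

HB.mixin Record isTopGroup G & PreTopGroup G := {
  mulg_continuous : continuous (fun gh : G * G => (gh.1 * gh.2)%g);
  invg_continuous : continuous (fun g : G => (g^-1)%g)
}.

#[short(type="topGroupType")]
HB.structure Definition TopGroup := {G of PreTopGroup G & isTopGroup G}.

(* Class C^k on an open set U; the spaces V, W of interest are finite
   dimensional, so that the differential is C^k as soon as all directional
   derivatives are. *)
Fixpoint class_C (R : realType) (V W : normedModType R) (k : nat) (U : set V)
    (f : V -> W) : Prop :=
  if k is k'.+1 then
    (forall x, U x -> differentiable f x) /\
    (forall v : V, class_C k' U (fun x => 'D_v f x))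
  else forall x, U x -> {for x, continuous f}.

Definition smooth_on (R : realType) (V W : normedModType R) (U : set V)
    (f : V -> W) : Prop := forall k, class_C k U f.

(* [chart_fun] and [chart_inv] are total functions, meaningful only on
   [chart_dom] and its image [chart_codom]. *)
Record chart (R : realType) (n : nat) (M : topologicalType) := Chart {
  chart_dom : set M;
  chart_fun : M -> 'rV[R]_n;
  chart_inv : 'rV[R]_n -> M;
  chart_dom_open : open chart_dom;
  chart_codom_open : open (chart_fun @` chart_dom);
  chart_fun_continuous : forall x, chart_dom x -> {for x, continuous chart_fun};
  chart_inv_continuous : forall u, (chart_fun @` chart_dom) u ->
    {for u, continuous chart_inv};
  chart_funK : forall x, chart_dom x -> chart_inv (chart_fun x) = x
}.

Definition chart_codom (R : realType) (n : nat) (M : topologicalType)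
  (c : chart R n M) : set 'rV[R]_n := chart_fun c @` chart_dom c.

Record smooth_atlas (R : realType) (n : nat) (M : topologicalType) :=
  SmoothAtlas {
    charts : set (chart R n M);
    charts_cover : forall x, exists2 c, charts c & chart_dom c x;
    charts_compatible : forall c d, charts c -> charts d ->
      smooth_on (chart_fun c @` (chart_dom c `&` chart_dom d))
                (chart_fun d \o chart_inv c)
  }.

Definition smooth_mulg (R : realType) (n : nat) (G : preTopGroupType)
    (A : smooth_atlas R n G) : Prop :=
  forall c1 c2 c3 : chart R n G, charts A c1 -> charts A c2 -> charts A c3 ->
    smooth_on
      [set u : 'rV[R]_n * 'rV[R]_n | [/\ chart_codom c1 u.1,
         chart_codom c2 u.2 &
         chart_dom c3 (chart_inv c1 u.1 * chart_inv c2 u.2)%g]]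
      (fun u : 'rV[R]_n * 'rV[R]_n =>
         chart_fun c3 (chart_inv c1 u.1 * chart_inv c2 u.2)%g).

Definition smooth_invg (R : realType) (n : nat) (G : preTopGroupType)
    (A : smooth_atlas R n G) : Prop :=
  forall c1 c2 : chart R n G, charts A c1 -> charts A c2 ->
    smooth_on
      [set u | chart_codom c1 u /\ chart_dom c2 ((chart_inv c1 u)^-1)%g]
      (fun u => chart_fun c2 ((chart_inv c1 u)^-1)%g).

(* No countability axiom is imposed: Lie groups may have arbitrarily many
   connected components (and may be discrete, with [lie_dim = 0]). *)
HB.mixin Record isLieGroup (R : realType) G & TopGroup G := {
  lie_dim : nat;
  lie_atlas : smooth_atlas R lie_dim G;
  lie_hausdorff : hausdorff_space G;
  lie_smooth_mulg : smooth_mulg lie_atlas;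
  lie_smooth_invg : smooth_invg lie_atlas
}.

#[short(type="lieGroupType")]
HB.structure Definition LieGroup (R : realType) :=
  {G of TopGroup G & isLieGroup R G}.

Record continuous_action (G : topGroupType) (X : topologicalType) :=
  ContinuousAction {
    act :> G -> X -> X;
    act1 : forall x, act 1%g x = x;
    actM : forall g h x, act (g * h)%g x = act g (act h x);
    act_continuous : continuous (fun gx : G * X => act gx.1 gx.2)
  }.

Definition faithful_action (G : topGroupType) (X : topologicalType)
    (a : continuous_action G X) : Prop :=
  forall g : G, (forall x, a g x = x) -> g = 1%g.

Section orbit_space.
Context (G : topGroupType) (X : topologicalType) (a : continuous_action G X).

Definition same_orbit : rel X := fun x y => `[< exists g : G, y = a g x >].

Lemma same_orbit_is_equiv : equiv_class_of same_orbit.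
Proof.
split=> [x|x y|y x z].
- by apply/asboolP; exists 1%g; rewrite act1.
- apply/asboolP/asboolP => -[g ->]; exists (g^-1)%g;
    by rewrite -actM mulVg act1.
- move=> /asboolP[g ->] /asboolP[h ->].
  by apply/asboolP; exists (h * g)%g; rewrite actM.
Qed.

Canonical same_orbit_equiv := EquivRelPack same_orbit_is_equiv.

Definition orbit_space : topologicalType :=
  quotient_topology {eq_quot same_orbit_equiv}%qT.

Definition orbit_proj : X -> orbit_space := \pi_orbit_space%qT.

End orbit_space.

Definition polar_space (R : realType) (G : lieGroupType R) (X : topologicalType)
    (a : continuous_action G X) : Prop :=
  [/\ faithful_action a,
      [/\ hausdorff_space X, connected_space X, locally_path_connected R X &
          semilocally_simply_connected R X],
      simply_connected R (orbit_space a) &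
      exists x : orbit_space a -> X,
        [/\ continuous x,
            forall q, orbit_proj a (x q) = q &
            quotient_map (fun gq : G * orbit_space a => a gq.1 (x gq.2))]].

(* [S] is the set of sheets over [U]; each sheet is mapped homeomorphically
   onto [U] by [p], with inverse [s]. *)
Definition evenly_covered (E B : topologicalType) (p : E -> B) (U : set B) :
    Prop :=
  exists S : set (set E),
    [/\ p @^-1` U = \bigcup_(V in S) V,
        forall V, S V -> open V,
        forall V W, S V -> S W -> V `&` W !=set0 -> V = W &
        forall V, S V -> exists s : B -> E,
          [/\ {within U, continuous s},
              forall y, U y -> V (s y) /\ p (s y) = y &
              forall z, V z -> s (p z) = z]].

Definition covering (E B : topologicalType) (p : E -> B) : Prop :=
  [/\ continuous p, set_surj setT setT p &
      forall y, exists U : set B, [/\ open U, U y & evenly_covered p U]].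

Definition universal_covering (R : realType) (E B : topologicalType)
    (p : E -> B) : Prop :=
  covering p /\ simply_connected R E.

Definition deck_transformation (E B : topologicalType) (p : E -> B)
    (d : E -> E) : Prop :=
  homeomorphism d /\ p \o d = p.

Definition galois_covering (E B : topologicalType) (p : E -> B) : Prop :=
  [/\ covering p, connected_space E &
      forall e e' : E, p e = p e' ->
        exists2 d, deck_transformation p d & d e = e'].

Section lifted_group.
Context (G : topGroupType) (X : topologicalType) (a : continuous_action G X).
Context (X' : topologicalType) (p : X' -> X).

Definition lifted_group : set (X' -> X') :=
  [set g' | homeomorphism g' /\ exists g : G, p \o g' = a g \o p].

(* The chosen [g] is the only one, by [lifted_group_proj_eq]. *)
Definition lifted_group_proj (g' : lifted_group) : G :=
  projT1 (cid (set_valP g').2).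

Lemma lifted_group_projP (g' : lifted_group) :
  p \o val g' = a (lifted_group_proj g') \o p.
Proof. exact: (projT2 (cid (set_valP g').2)). Qed.

Lemma lifted_group_proj_eq (g' : lifted_group) (g : G) :
  faithful_action a -> set_surj setT setT p ->
  p \o val g' = a g \o p -> lifted_group_proj g' = g.
Proof.
move=> fa ps h; have h' := lifted_group_projP g'.
suff e : (g^-1 * lifted_group_proj g')%g = 1%g.
  by apply: (mulgI g^-1%g); rewrite e mulVg.
apply: fa => x; have [e _ <-] := ps x I.
have -> : a (g^-1 * lifted_group_proj g')%g (p e) =
          a g^-1%g ((a (lifted_group_proj g') \o p) e) by rewrite actM.
by rewrite -h' h /= -actM mulVg act1.
Qed.

End lifted_group.

Definition polar_covering (G : topGroupType) (X : topologicalType)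
    (a : continuous_action G X) (X' : topologicalType) (p : X' -> X) : Prop :=
  [/\ covering p, connected_space X', galois_covering p &
      set_surj setT setT (@lifted_group_proj G X a X' p)].

(* Main.v *)
Require Import Defs.
From mathcomp Require Import all_boot all_order all_algebra.
From mathcomp Require Import all_classical all_reals all_analysis.
From mathcomp Require Import homotopy lra.
Import Order.TTheory GRing.Theory Num.Theory.
Import numFieldNormedType.Exports.

Set Implicit Arguments.
Unset Strict Implicit.
Unset Printing Implicit Defensive.

Local Open Scope classical_set_scope.
Local Open Scope ring_scope.

(** A universal covering is simply connected, and, being locally homeomorphic
    to the base, it is locally path-connected. The lifting criterion
    ([lift_simply_connected]) therefore applies to maps defined on it: for every
    self-homeomorphism [f] of the base and all points [e0], [e1] with
    [p e1 = f (p e0)], the map [f \o p] lifts to a map [h] sending [e0] to [e1].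
    The inverse of [f] lifts likewise to a map sending [e1] to [e0], and both
    composites lift the projection and fix a point, so uniqueness of lifts makes
    them identities ([lift_homeomorphism]). With [f] the identity this says that
    the covering is Galois; with [f] the action of [g] it says that [g] is in
    the image of the lifted group.

    The lifting criterion rests on a homotopy lifting property
    ([local_homotopy_lift]): a map [H : Y * R -> B], already lifted at
    nonpositive times, lifts up to any time [t] over a neighborhood of a given
    point of [Y]. Taking no account of [Y] yields path lifting. Taking for [Y]
    the parameter of a null-homotopy of a loop shows that the endpoints of the
    lifts of its intermediate loops form a continuous family in a fiber, hence
    a constant one; so null-homotopic loops lift to loops
    ([null_homotopic_lift_closed]), and the endpoint of the lift of [f \o c]
    depends only on the endpoints of the path [c] in the simply connected
    source. That endpoint is the value of the lift of [f].

    Paths are functions on the whole real line that are constant on both sides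
    of the unit interval. Concatenation, reversal and lifting then need no
    change of domain, and continuity is only ever required at the points of open
    sets. *)

(** * Local continuity and gluing *)

Lemma near_eq_continuous_at (S T : topologicalType) (f g : S -> T) (x : S) :
  (\forall z \near x, f z = g z) ->
  {for x, continuous f} -> {for x, continuous g}.
Proof.
move=> fg cf; rewrite /prop_for /continuous_at -(nbhs_singleton fg).
by apply: cvg_trans cf; exact: near_eq_cvg.
Qed.

Lemma continuous_at_pair (S T U : topologicalType) (f : S -> T) (g : S -> U)
    (x : S) :
  {for x, continuous f} -> {for x, continuous g} ->
  {for x, continuous (fun z => (f z, g z))}.
Proof. exact: cvg_pair. Qed.

Lemma continuous_glue (R : realType) (T : topologicalType) (f g : R -> T)
    (a : R) :
  continuous f -> continuous g -> f a = g a ->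
  continuous (fun t => if t < a then f t else g t).
Proof.
move=> cf cg fga t; have [ta|ta|->] := ltgtP t a.
- apply: (near_eq_continuous_at _ (cf t)).
  by near=> u; rewrite ifT //; near: u; exact: lt_nbhsl.
- apply: (near_eq_continuous_at _ (cg t)).
  near=> u; rewrite ifF //; apply/negbTE; rewrite -leNgt ltW //.
  by near: u; exact: lt_nbhsr.
- move=> W /=; rewrite ltxx => Wa.
  have fW : \forall u \near a, W (f u) by apply: cf; rewrite fga.
  have gW : \forall u \near a, W (g u) by exact: cg.
  by apply: filterS2 fW gW => u /= fu gu; case: ifP.
Unshelve. all: by end_near. Qed.

(** * Sheets and uniqueness of lifts *)

(** Each point [e] over [U] names the sheet [V e] through it and its section
    [s e]. This spares the quantification over sheets, and the last clause keeps
    the disjointness: sheets that meet are equal. *)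
Lemma covering_sheets (E B : topologicalType) (p : E -> B) (x : B) :
  covering p ->
  exists (U : set B) (V : E -> set E) (s : E -> B -> E),
  [/\ open U, U x,
    forall e, U (p e) ->
      [/\ open (V e), V e e,
        forall z, V e z -> U (p z) /\ s e (p z) = z &
        forall y, U y ->
          [/\ {for y, continuous (s e)}, V e (s e y) & p (s e y) = y]] &
    forall e e' w, U (p e) -> U (p e') -> V e w -> V e' w -> V e = V e'].
Proof.
move=> [_ _ /(_ x)[U [oU Ux [S [pUE oS disjS secS]]]]].
have /choice[Vs VsP] : forall e, exists Vs : set E * (B -> E), U (p e) ->
    [/\ S Vs.1, Vs.1 e, {within U, continuous Vs.2},
      forall y, U y -> Vs.1 (Vs.2 y) /\ p (Vs.2 y) = y &
      forall z, Vs.1 z -> Vs.2 (p z) = z].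
  move=> e; have [Ue|nUe] := pselect (U (p e)); last by exists (set0, cst e).
  have : (p @^-1` U) e by [].
  rewrite pUE => -[V SV Ve]; have [s [cs sV sp]] := secS _ SV.
  by exists (V, s).
exists U, (fun e => (Vs e).1), (fun e => (Vs e).2); split=> //.
  move=> e /VsP[SV Ve cs sV sp]; split=> //; first exact: oS.
    move=> z Vz; split; last exact: sp.
    suff : (p @^-1` U) z by [].
    by rewrite pUE; exists (Vs e).1.
  move=> y Uy; have [sy psy] := sV _ Uy; split=> //.
  by move: cs; rewrite continuous_open_subspace// => /(_ y); apply; rewrite inE.
move=> e e' w /VsP[SV _ _ _ _] /VsP[SV' _ _ _ _] Vw V'w.
by apply: disjS => //; exists w.
Qed.

(** The coincidence set is open because [p] is injective on a sheet, and its
    complement is open because distinct points of a fiber lie on disjoint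
    sheets. Working on an open part [A] of the source allows lifts that exist
    only there. *)
Lemma unique_lift (Z E B : topologicalType) (p : E -> B) (A : set Z)
    (c d : Z -> E) (z0 : Z) :
  covering p -> open A -> connected A ->
  (forall z, A z -> {for z, continuous c}) ->
  (forall z, A z -> {for z, continuous d}) ->
  (forall z, A z -> p (c z) = p (d z)) ->
  A z0 -> c z0 = d z0 -> forall z, A z -> c z = d z.
Proof.
move=> covp oA cA cc cd pcd Az0 cdz0.
have near_sheets z : A z -> exists (V V' : set E),
    [/\ open_nbhs (c z) V, open_nbhs (d z) V',
      forall u v, V u -> V v -> p u = p v -> u = v &
      c z <> d z -> V `&` V' = set0].
  move=> Az.
  have [U [V [s [oU Uz Vp Vdisj]]]] := covering_sheets (p (c z)) covp.
  have [oV Vc Vs sV] := Vp _ Uz.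
  have Uz' : U (p (d z)) by rewrite -pcd.
  have [oV' Vc' Vs' sV'] := Vp _ Uz'.
  exists (V (c z)), (V (d z)); split=> //.
    by move=> u v /Vs[_ {2}<-] /Vs[_ {2}<-] ->.
  move=> ncd; rewrite -subset0 => w [Vw V'w]; apply: ncd.
  have VV := Vdisj _ _ _ Uz Uz' Vw V'w.
  by rewrite -(Vs _ Vc).2 pcd//; apply: (Vs _ _).2; rewrite VV.
pose D := [set z | A z /\ c z = d z].
suff : D = A by move=> DA z; rewrite -{1}DA => -[].
apply: cA; first by exists z0.
  exists D; last by rewrite predeqE => z; split=> [[]//|[]].
  rewrite openE => z [Az cdz].
  have [V [V' [oVc oVd inj _]]] := near_sheets z Az.
  have nc : \forall u \near z, V (c u).
    by apply: cc => //; exact: open_nbhs_nbhs.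
  have nd : \forall u \near z, V (d u).
    by apply: cd => //; rewrite -cdz; exact: open_nbhs_nbhs.
  have nA : \forall u \near z, A u by exact: open_nbhs_nbhs.
  near=> u; have Au : A u by near: u.
  by split=> //; apply: inj; [near: u|near: u|exact: pcd].
exists (~` [set z | A z /\ c z <> d z]); last first.
  rewrite predeqE => z; split=> [[Az e]|[Az /not_andP[//|/contrapT e]]].
    by split=> // -[_].
  by split.
rewrite closedC openE => z [Az cdz].
have [V [V' [oVc oVd _ /(_ cdz) VV0]]] := near_sheets z Az.
have nc : \forall u \near z, V (c u) by apply: cc => //; exact: open_nbhs_nbhs.
have nd : \forall u \near z, V' (d u) by apply: cd => //; exact: open_nbhs_nbhs.
have nA : \forall u \near z, A u by exact: open_nbhs_nbhs.
near=> u; split; first by near: u.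
move=> cdu; suff : (V `&` V') (c u) by rewrite VV0.
by split; [near: u|rewrite cdu; near: u].
Unshelve. all: by end_near. Qed.

(** * Homotopy lifting *)

Lemma ray_open_connected (R : realType) (t : R) :
  open `]-oo, t[%classic /\ connected `]-oo, t[%classic.
Proof.
split; first exact: interval_open.
by apply/connected_intervalP; exact: interval_is_interval.
Qed.

(** The set of times [t] satisfying the conclusion is closed downwards and has
    0 in it. Were it bounded, a lift reaching a time close enough to its
    supremum [c] could be prolonged beyond [c] by the section of a sheet over a
    neighborhood of [H (y0, c)]. The lift and that section agree on an open
    strip around a time [t1], so that the two pieces overlap on an open set and
    no closed gluing is needed. *)
Lemma local_homotopy_lift (R : realType) (Y E B : topologicalType) (p : E -> B)
    (H : Y * R -> B) (f : Y -> E) (y0 : Y) (t : R) :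
  covering p -> continuous H -> continuous f ->
  (forall y u, u <= 0 -> H (y, u) = p (f y)) ->
  exists (N : set Y) (K : Y * R -> E), [/\ open N, N y0 &
    forall y u, N y -> u < t -> [/\ {for (y, u), continuous K},
      p (K (y, u)) = H (y, u) & u <= 0 -> K (y, u) = f y]].
Proof.
move=> covp cH cf Hf.
pose good t := exists (N : set Y) (K : Y * R -> E), [/\ open N, N y0 &
    forall y u, N y -> u < t -> [/\ {for (y, u), continuous K},
      p (K (y, u)) = H (y, u) & u <= 0 -> K (y, u) = f y]].
rewrite -/(good t).
have good0 : good 0.
  exists setT, (f \o fst); split=> //; first exact: openT.
  move=> y u _ u0; split=> //; last by rewrite Hf// ltW.
  by apply: continuous_comp; [exact: cvg_fst|exact: cf].
have good_le u v : u <= v -> good v -> good u.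
  move=> uv [N [K [oN Ny NK]]]; exists N, K; split=> // y w Ny' wu.
  by apply: NK => //; exact: lt_le_trans uv.
have extend c : exists2 eps, 0 < eps &
    forall u, c - eps < u -> good u -> good (c + eps).
  have [U [V [s [oU Ux Vp _]]]] := covering_sheets (H (y0, c)) covp.
  have : nbhs (y0, c) (H @^-1` U) by apply: cH; exact: open_nbhs_nbhs.
  move=> -[[P Q] /= [nP /nbhs_ballP[e /= e0 eQ]] PQU].
  have HU y u : P y -> `|u - c| < e -> U (H (y, u)).
    move=> Py uc; apply: (PQU (y, u)); split=> //=; apply: eQ.
    by rewrite /ball /= distrC.
  exists (e / 2); first by rewrite divr_gt0.
  move=> w cw [N [K [oN Ny NK]]].
  (* the given lift is defined at t1, and H stays in U between t1 and c + e/2 *)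
  have [t1 [ct1 t1w t1c]] : exists t1, [/\ c - e / 2 < t1, t1 < w & t1 <= c].
    have [wc|cw'] := leP w c.
      by exists ((c - e / 2 + w) / 2); split; lra.
    by exists c; split=> //; lra.
  have [cK pK Kf] := NK _ _ Ny t1w.
  set e1 := K (y0, t1).
  have Ue1 : U (p e1).
    rewrite pK; apply: HU; first exact: nbhs_singleton.
    by rewrite ltr_norml; lra.
  have [oV Ve1 Vs sV] := Vp _ Ue1.
  have : nbhs (y0, t1) (K @^-1` V e1) by apply: cK; exact: open_nbhs_nbhs.
  move=> -[[P' Q'] /= [nP' /nbhs_ballP[e' /= e'0 eQ']] PQV].
  (* d is the half-width of a strip around t1 on which the lift is defined and
     stays in the sheet V e1 *)
  have [d [d0 dw de']] : exists d, [/\ 0 < d, t1 + d <= w & d <= e'].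
    exists (Num.min (w - t1) e').
    rewrite lt_min e'0 subr_gt0 t1w; split=> //.
      by rewrite -lerBrDl ge_min lexx.
    by rewrite ge_min lexx orbT.
  pose M := N `&` (P `&` P')°.
  have agree y u : M y -> `|u - t1| < d -> s e1 (H (y, u)) = K (y, u).
    move=> [My /interior_subset[Py P'y]] ut.
    move: (ut); rewrite ltr_norml => /andP[ut1 ut2].
    have uw : u < w by lra.
    have [_ <- _] := NK _ _ My uw.
    apply: (Vs _ _).2; apply: (PQV (y, u)); split=> //=; apply: eQ'.
    by rewrite /ball /= distrC; lra.
  pose K' (z : Y * R) := if z.2 < t1 then K z else s e1 (H z).
  exists M, K'; split.
  - by apply: openI => //; exact: open_interior.
  - split=> //; apply: filterI => //.
  move=> y u My uc.
  have [My1 /interior_subset[My2 My3]] := My.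
  have nM : nbhs y M.
    apply: open_nbhs_nbhs; split=> //.
    by apply: openI => //; exact: open_interior.
  have [ut1|t1u] := ltP u t1.
    have uw : u < w by exact: lt_trans t1w.
    have [cKu pKu Kfu] := NK _ _ My1 uw.
    rewrite /K' /= ut1; split=> //.
    apply: near_eq_continuous_at cKu.
    have nt : \forall z \near (y, u), z.2 < t1.
      exists (setT, [set v | v < t1]) => /=; last by move=> z [].
      by split; [exact: filterT|exact: lt_nbhsl].
    by apply: filterS nt => z /= ->.
  have Uu : U (H (y, u)) by apply: HU => //; rewrite ltr_norml; lra.
  have [cs Vsu psu] := sV _ Uu.
  rewrite /K' /= ltNge t1u /=; split=> //; last first.
    (* at times u <= 0 past t1, the path H (y, _) has not moved since t1 *)
    move=> u0; rewrite Hf//.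
    have t10 : t1 <= 0 by exact: le_trans u0.
    have [_ _ /(_ t10) Kfy] := NK _ _ My1 t1w.
    by rewrite -(Hf _ _ t10) agree// subrr normr0.
  have csH : {for (y, u), continuous (s e1 \o H)}.
    by apply: continuous_comp; [exact: cH|].
  apply: near_eq_continuous_at csH.
  have nz : \forall z \near (y, u), M z.1 /\ t1 - d < z.2.
    exists (M, [set v | t1 - d < v]) => //=; split=> //.
    by apply: lt_nbhsr; lra.
  apply: filterS nz => -[y' v] /= [My' tv]; case: ifPn => // vt1.
  by apply: agree => //; rewrite ltr_norml; lra.
apply: contrapT => ngood.
have bounded : has_sup [set u | good u].
  split; first by exists 0.
  exists t => u gu; rewrite leNgt; apply/negP => tu; apply: ngood.
  exact: good_le (ltW tu) gu.
have [e e0 ext] := extend (sup [set u | good u]).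
have [u gu uc] := sup_adherent e0 bounded.
have /(ub_le_sup bounded.2) := ext _ uc gu.
by rewrite leNgt ltrDl e0.
Qed.

(** * Paths parametrized by the real line *)

Definition real_path (R : realType) (T : topologicalType) (x y : T)
    (c : R -> T) : Prop :=
  [/\ continuous c, forall t, t <= 0 -> c t = x & forall t, 1 <= t -> c t = y].

Section real_paths.
Context {R : realType}.

Lemma real_path_comp (S T : topologicalType) (f : S -> T) (x y : S)
    (c : R -> S) :
  continuous f -> real_path x y c -> real_path (f x) (f y) (f \o c).
Proof.
move=> cf [cc c0 c1]; split=> [t|t /c0/= ->//|t /c1/= ->//].
by apply: continuous_comp; [exact: cc|exact: cf].
Qed.

Definition concat (T : Type) (c d : R -> T) : R -> T :=
  fun t => if t < 1 / 2 then c (2 * t) else d (2 * t - 1).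

Lemma real_path_concat (T : topologicalType) (x y z : T) (c d : R -> T) :
  real_path x y c -> real_path y z d -> real_path x z (concat c d).
Proof.
move=> [cc c0 c1] [cd d0 d1]; split=> [|t t0|t t1]; last 2 first.
- by rewrite /concat ifT ?c0//; lra.
- by rewrite /concat ifF ?d1//; [lra|apply/negbTE; rewrite -leNgt; lra].
apply: (@continuous_glue _ _ (fun t => c (2 * t)) (fun t => d (2 * t - 1))).
- move=> t.
  apply: (@continuous_comp _ _ _ (fun t : R => 2 * t) c); last exact: cc.
  exact: mulrl_continuous.
- move=> t.
  apply: (@continuous_comp _ _ _ (fun t : R => 2 * t - 1) d); last exact: cd.
  by apply: cvgB; [exact: mulrl_continuous|exact: cvg_cst].
- by rewrite c1 ?d0//; lra.
Qed.

Lemma real_path_rev (T : topologicalType) (x y : T) (c : R -> T) :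
  real_path x y c -> real_path y x (fun t => c (1 - t)).
Proof.
move=> [cc c0 c1]; split=> [t|t t0|t t1]; last 2 first.
- by rewrite c1//; lra.
- by rewrite c0//; lra.
apply: (@continuous_comp _ _ _ (fun t : R => 1 - t) c); last exact: cc.
by apply: cvgB; [exact: cvg_cst|exact: cvg_id].
Qed.

Lemma real_path_cst (T : topologicalType) (x : T) :
  @real_path R T x x (fun=> x).
Proof. by split=> // t; exact: cvg_cst. Qed.

Lemma clamp_subproof (t : R) :
  Num.max 0 (Num.min t 1) \in `[0 : R, 1]%classic.
Proof.
by rewrite inE /= in_itv /= le_max lexx /= ge_max ler01 ge_min lexx orbT.
Qed.

Definition clamp (t : R) : unit_interval R := SigSub (clamp_subproof t).

Lemma clamp_continuous : continuous clamp.
Proof.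
apply: continuous_comp_initial => t.
apply: (@continuous_max R R (cst 0) (fun t => Num.min t 1) t).
  exact: cvg_cst.
by apply: (@continuous_min R R id (cst 1) t); [exact: cvg_id|exact: cvg_cst].
Qed.

Lemma clamp0 t : t <= 0 -> clamp t = zero.
Proof.
move=> t0; apply/val_inj => /=; rewrite min_l; last by lra.
by rewrite max_l.
Qed.

Lemma clamp1 t : 1 <= t -> clamp t = one.
Proof. by move=> t1; apply/val_inj => /=; rewrite min_r// max_r. Qed.

Lemma path_real_path (T : topologicalType) (x y : T)
    (c : {path (unit_interval R) from x to y in T}) :
  real_path x y (c \o clamp).
Proof.
split=> [t|t t0|t t1] /=; last 2 first.
- by rewrite clamp0// path_zero.
- by rewrite clamp1// path_one.
by apply: continuous_comp; [exact: clamp_continuous|exact: cts_fun].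
Qed.

Lemma path_connected_real_path (T : topologicalType) (A : set T) (x y : T) :
  path_connected R A -> A x -> A y ->
  exists c : R -> T, real_path x y c /\ forall t, A (c t).
Proof.
move=> [_ Ac] Ax Ay; have [c cA] := Ac _ _ Ax Ay.
by exists (c \o clamp); split=> [|t]; [exact: path_real_path|exact: cA].
Qed.

Lemma path_connected_connected (T : topologicalType) :
  path_connected R [set: T] -> connected [set: T].
Proof.
move=> pT; have [[x _] _] := pT.
suff -> : [set: T] =
    \bigcup_(c in [set c : R -> T | continuous c /\ c 0 = x]) range c.
  apply: bigcup_connected => [|c [cc _]].
    by exists x => c [_ cx]; exists 0.
  apply: connected_continuous_connected; last exact: continuous_subspaceT.
  by apply/connected_intervalP => ? ?.
apply/esym; rewrite -subTset => y _.
have [c [[cc c0 c1] _]] :=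
  path_connected_real_path pT (I : setT x) (I : setT y).
by exists c; [split=> //; exact: c0|exists 1 => //; exact: c1].
Qed.

(** The deformation parameter is the first argument, and both arguments range
    over the line, as in [local_homotopy_lift]. *)
Lemma null_homotopic_loop (T : topologicalType) (x : T) (c : R -> T) :
  simply_connected R T -> real_path x x c ->
  exists H : R * R -> T, [/\ continuous H, forall t, H (0, t) = c t &
    [/\ forall u t, t <= 0 -> H (u, t) = x, forall u t, 1 <= t -> H (u, t) = x &
     forall t, H (1, t) = x]].
Proof.
move=> [_ scT] [cc c0 c1].
pose c' : unit_interval R -> T := c \o val.
have cc' : continuous c'.
  by move=> s; apply: continuous_comp; [exact: initial_continuous|exact: cc].
have c'0 : c' zero = x by exact: c0.
have c'1 : c' one = x by exact: c1.
have [H [cH H0 H1 Hl Hr]] := scT x (mk_path cc' c'0 c'1).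
exists (fun z => H (clamp z.2, clamp z.1)); split.
- move=> z; apply: (@continuous_comp _ _ _ (fun z => (clamp z.2, clamp z.1)) H);
    last exact: cH.
  apply: continuous_at_pair.
    apply: (@continuous_comp _ _ _ snd clamp); first exact: cvg_snd.
    exact: clamp_continuous.
  apply: (@continuous_comp _ _ _ fst clamp); first exact: cvg_fst.
  exact: clamp_continuous.
- move=> t /=; rewrite (clamp0 (lexx _)) H0 /= /mk_path /c' /=.
  have [t0|t0] := leP t 0; first by rewrite max_l ?c0// min_l//; lra.
  have [t1|t1] := leP 1 t; first by rewrite max_r// !c1.
  by rewrite max_r// ltW.
- split=> [u t t0|u t t1|t] /=.
  + by rewrite clamp0.
  + by rewrite (clamp1 t1).
  + by rewrite (clamp1 (lexx _)) H1.
Qed.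

End real_paths.

(** * Path lifting and monodromy *)

Section lifting.
Context {R : realType} {E B : topologicalType} {p : E -> B}.
Context (covp : covering p).

Lemma real_line_connected : connected [set: R].
Proof. by apply/connected_intervalP => ? ?. Qed.

Lemma unique_path_lift (c d : R -> E) :
  continuous c -> continuous d -> (forall t, p (c t) = p (d t)) ->
  c 0 = d 0 -> c =1 d.
Proof.
move=> cc cd pcd c0 t.
apply: (unique_lift covp openT real_line_connected _ _ _ _ c0) => // z _.
- exact: cc.
- exact: cd.
Qed.

Lemma path_lift (e : E) (y : B) (c : R -> B) :
  real_path (p e) y c ->
  exists e' d, real_path e e' d /\ forall t, p (d t) = c t.
Proof.
move=> [cc c0 c1].
have cH : continuous (c \o snd : R * R -> B).
  by move=> z; apply: continuous_comp; [exact: cvg_snd|exact: cc].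
have ce : continuous (cst e : R -> E) by move=> y0; exact: cvg_cst.
have [N [K [oN N0 NK]]] := @local_homotopy_lift R R E B p _ _ 0 2 covp cH ce
  (fun _ u u0 => c0 u u0).
(* the lift exists up to time 2; beyond time 1 it is frozen, as c is *)
exists (K (0, 1)), (fun t => K (0, Num.min t 1)).
have lt2 t : Num.min t 1 < 2 :> R by rewrite gt_min; apply/orP; right; lra.
split; last first.
  move=> t; have [_ -> _] := NK _ _ N0 (lt2 t); rewrite /=.
  by have [//|t1] := leP t 1; rewrite !c1// ltW.
split=> [t|t t0|t t1].
- have [cK _ _] := NK _ _ N0 (lt2 t).
  apply: (@continuous_comp _ _ _ (fun t : R => (0 : R, Num.min t 1)) K) => //.
  apply: continuous_at_pair; first exact: cvg_cst.
  by apply: (@continuous_min R R id (cst 1) t); [exact: cvg_id|exact: cvg_cst].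
- have -> : Num.min t 1 = t by rewrite min_l//; lra.
  by have [_ _ ->] := NK _ t N0 (le_lt_trans t0 (ltr0Sn _ _)).
- by rewrite min_r.
Qed.

(** Let [D u] be the lift of [H (u, _)] starting at [e]. Its endpoint is
    continuous in [u], by local homotopy lifting and uniqueness of lifts, and
    stays in the fiber of [x]; so it is constant. For [u = 1] the path is
    constant and the endpoint is [e], while [D 0] is the given lift [d]. *)
Lemma null_homotopic_lift_closed (H : R * R -> B) (x : B) (e e' : E)
    (d : R -> E) :
  continuous H -> (forall u t, t <= 0 -> H (u, t) = x) ->
  (forall u t, 1 <= t -> H (u, t) = x) -> (forall t, H (1, t) = x) ->
  real_path e e' d -> (forall t, p (d t) = H (0, t)) -> e' = e.
Proof.
move=> cH H0 H1 Hx [cd d0 d1] pd.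
have pe : p e = x by rewrite -(d0 0)// pd H0.
have /choice[D DP] u : exists D : R -> E,
    [/\ continuous D, D 0 = e & forall t, p (D t) = H (u, t)].
  have [|e1 [D [[cD D0 D1] pD]]] := @path_lift e x (fun t => H (u, t)).
    split=> [t|t t0|t t1]; [|by rewrite pe H0|by rewrite H1].
    apply: (@continuous_comp _ _ _ (fun t : R => (u, t)) H); last exact: cH.
    by apply: continuous_at_pair; [exact: cvg_cst|exact: cvg_id].
  by exists D; split=> //; exact: D0.
have cphi : continuous (fun u => D u 1).
  move=> u0.
  have ce : continuous (cst e : R -> E) by move=> y0; exact: cvg_cst.
  have He u t : t <= 0 -> H (u, t) = p e by move=> t0; rewrite H0.
  have [N [K [oN N0 NK]]] :=
    @local_homotopy_lift R R E B p _ _ u0 2 covp cH ce He.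
  have one2 : 1 < 2 :> R by lra.
  have [cK _ _] := NK _ _ N0 one2.
  have KD : \forall u \near u0, K (u, 1) = D u 1.
    have nN : \forall u \near u0, N u by exact: open_nbhs_nbhs.
    apply: filterS nN => u Nu; have [cDu Du0 pDu] := DP u.
    have [op2 cn2] := ray_open_connected (2 : R).
    have in2 t : `]-oo, 2[%classic t -> t < 2 by rewrite /= in_itv.
    apply: (@unique_lift _ _ _ p _ (fun t => K (u, t)) (D u) 0 covp op2 cn2).
    + move=> t /in2 t2; have [cKt _ _] := NK _ _ Nu t2.
      apply: (@continuous_comp _ _ _ (fun t : R => (u, t)) K) => //.
      by apply: continuous_at_pair; [exact: cvg_cst|exact: cvg_id].
    + by move=> t _; exact: cDu.
    + by move=> t /in2 t2; have [_ -> _] := NK _ _ Nu t2; rewrite pDu.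
    + by rewrite /= in_itv /=; lra.
    + have lt02 : 0 < 2 :> R by lra.
      by have [_ _ ->//] := NK _ _ Nu lt02; rewrite Du0.
    + by rewrite /= in_itv /=.
  apply: (near_eq_continuous_at KD).
  apply: (@continuous_comp _ _ _ (fun u : R => (u, 1 : R)) K) => //.
  by apply: continuous_at_pair; [exact: cvg_id|exact: cvg_cst].
have phi_cst : (fun u => D u 1) =1 fun=> D 0 1.
  apply: unique_path_lift => //; first by move=> ?; exact: cvg_cst.
  by move=> u; have [_ _ ->] := DP u; have [_ _ ->] := DP 0; rewrite !H1.
have D0d : D 0 =1 d.
  have [cD0 D00 pD0] := DP 0.
  by apply: unique_path_lift => // [t|]; [rewrite pD0 pd|rewrite D00 d0].
have D1e : D 1 =1 fun=> e.
  have [cD1 D10 pD1] := DP 1.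
  apply: unique_path_lift => // [?|t]; first exact: cvg_cst.
  by rewrite pD1 Hx.
by rewrite -(d1 1)// -D0d -(phi_cst 1) D1e.
Qed.

(** * The lifting criterion *)

(** Only the center of the neighborhood has to be joined to the nearby points,
    and the paths may run in the larger set [U]; this weak form passes easily
    from the base of a covering to its total space. *)
Definition locally_real_path_connected (T : topologicalType) : Prop :=
  forall (y : T) (U : set T), nbhs y U ->
    \forall y' \near y,
      exists c : R -> T, real_path y y' c /\ forall t, U (c t).

Lemma covering_locally_real_path_connected :
  locally_path_connected R B -> locally_real_path_connected E.
Proof.
move=> lB e O nO.
have [U [V [s [oU Ue Vp _]]]] := covering_sheets (p e) covp.
have [oV Ve Vs sV] := Vp _ Ue.
have [cs _ _] := sV _ Ue.
have nW : nbhs (p e) (s e @^-1` O `&` U).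
  apply: filterI; last exact: open_nbhs_nbhs.
  by apply: cs; rewrite (Vs _ Ve).2.
have [W [oW We WU pcW]] := lB _ _ nW.
have nV : \forall e' \near e, V e e' by exact: open_nbhs_nbhs.
have npW : \forall e' \near e, W (p e').
  by case: covp => cp _ _; apply: cp; exact: open_nbhs_nbhs.
apply: filterS2 nV npW => e' Ve' We'.
have [c [[cc c0 c1] cW]] := path_connected_real_path pcW We We'.
exists (s e \o c); split=> [|t]; last by have [] := WU _ (cW t).
split=> [t|t t0|t t1] /=.
- apply: continuous_comp; first exact: cc.
  by have [_ /sV[]] := WU _ (cW t).
- by rewrite c0// (Vs _ Ve).2.
- by rewrite c1// (Vs _ Ve').2.
Qed.

(** Two pairs are joined when a path in the fiber product of [f] and [p] links
    them. As [Y] is path-connected, every [y] is joined to the base pair by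
    some [e]; as loops of [Y] are null-homotopic, this [e] is unique. The
    resulting lift is continuous because near [y] it is [f] followed by the
    section of a sheet: short paths lift along that section. *)
Lemma lift_simply_connected (Y : topologicalType) (f : Y -> B) (y0 : Y)
    (e0 : E) :
  simply_connected R Y -> locally_real_path_connected Y -> continuous f ->
  p e0 = f y0 ->
  exists h : Y -> E, [/\ continuous h, p \o h = f & h y0 = e0].
Proof.
move=> scY lY cf pe0.
pose joined y e y' e' := exists (c : R -> Y) (d : R -> E),
  [/\ real_path y y' c, real_path e e' d & forall t, p (d t) = f (c t)].
have joined_trans y e y' e' y'' e'' :
    joined y e y' e' -> joined y' e' y'' e'' -> joined y e y'' e''.
  move=> [c [d [rc rd pd]]] [c' [d' [rc' rd' pd']]].
  exists (concat c c'), (concat d d'); split.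
  - exact: real_path_concat rc rc'.
  - exact: real_path_concat rd rd'.
  - by move=> t; rewrite /concat; case: ifP.
have joined_sym y e y' e' : joined y e y' e' -> joined y' e' y e.
  move=> [c [d [rc rd pd]]].
  exists (fun t => c (1 - t)), (fun t => d (1 - t)).
  by split=> //; exact: real_path_rev.
have joined_unique y e y' e1 e2 :
    joined y e y' e1 -> joined y e y' e2 -> e2 = e1.
  move=> j1 j2.
  have := joined_trans _ _ _ _ _ _ (joined_sym _ _ _ _ j1) j2.
  move=> [c [d [rc rd pd]]].
  have [H [cH Hc [H0 H1 Hx]]] := null_homotopic_loop scY rc.
  apply: (@null_homotopic_lift_closed (f \o H) (f y') e1 e2 d) => //=.
  - by move=> z; apply: continuous_comp; [exact: cH|exact: cf].
  - by move=> u t t0; rewrite H0.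
  - by move=> u t t1; rewrite H1.
  - by move=> t; rewrite Hx.
  - by move=> t; rewrite Hc.
have /choice[h hP] y : exists e, joined y0 e0 y e.
  have [c [rc _]] := path_connected_real_path scY.1 (I : setT y0) (I : setT y).
  have := real_path_comp cf rc; rewrite -pe0 => /path_lift[e [d [rd pd]]].
  by exists e, c, d.
have ph y : p (h y) = f y.
  by have [c [d [[_ _ c1] [_ _ d1] pd]]] := hP y; rewrite -(d1 1)// pd c1.
exists h; split; last 2 first.
- exact/funext.
- apply: joined_unique (hP y0).
  by exists (fun=> y0), (fun=> e0); split=> //; exact: real_path_cst.
move=> y.
have [U [V [s [oU Uy Vp _]]]] := covering_sheets (f y) covp.
have Uh : U (p (h y)) by rewrite ph.
have [oV Vh Vs sV] := Vp _ Uh.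
have nU : nbhs y (f @^-1` U) by apply: cf; exact: open_nbhs_nbhs.
have hs : \forall y' \near y, (s (h y) \o f) y' = h y'.
  apply: filterS (lY _ _ nU) => y' [c [[cc c0 c1] cU]].
  apply: (joined_unique y0 e0 y'); first exact: hP.
  apply: joined_trans (hP y) _.
  exists c, (s (h y) \o f \o c); split=> //; last first.
    by move=> t /=; have [_ _ ->] := sV _ (cU t).
  split=> [t|t t0|t t1] /=; last 2 first.
  - by rewrite c0// -ph (Vs _ Vh).2.
  - by rewrite c1.
  apply: (@continuous_comp _ _ _ (f \o c) (s (h y))).
    by apply: continuous_comp; [exact: cc|exact: cf].
  by have [] := sV _ (cU t).
apply: near_eq_continuous_at hs _.
by apply: continuous_comp; [exact: cf|have [] := sV _ Uy].
Qed.

Lemma lift_homeomorphism (f g : B -> B) (e0 e1 : E) :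
  simply_connected R E -> locally_path_connected R B ->
  continuous f -> continuous g -> cancel f g -> cancel g f ->
  p e1 = f (p e0) ->
  exists h : E -> E, [/\ homeomorphism h, p \o h = f \o p & h e0 = e1].
Proof.
move=> scE lB cf cg fK gK pe1.
have cp : continuous p by case: covp.
have lE := covering_locally_real_path_connected lB.
have lift k a b : continuous k -> p b = k (p a) ->
    exists h : E -> E, [/\ continuous h, p \o h = k \o p & h a = b].
  move=> ck pb; apply: lift_simply_connected => //.
  by move=> e; apply: continuous_comp; [exact: cp|exact: ck].
have [h [ch ph h01]] := lift f e0 e1 cf pe1.
have pe0 : p e0 = g (p e1) by rewrite pe1 fK.
have [k [ck pk k10]] := lift g e1 e0 cg pe0.
have phE e : p (h e) = f (p e) by rewrite -[LHS]/((p \o h) e) ph.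
have pkE e : p (k e) = g (p e) by rewrite -[LHS]/((p \o k) e) pk.
have lift_id (m : E -> E) e : continuous m -> (forall x, p (m x) = p x) ->
    m e = e -> forall x, m x = x.
  move=> cm pm me x.
  have cE := path_connected_connected scE.1.
  apply: (@unique_lift _ _ _ p setT m id e covp openT cE) => // z _.
  - exact: cm.
  - exact: cvg_id.
exists h; split=> //; split=> //; exists k; split=> //.
- apply: (lift_id (k \o h) e0) => [e|e|] /=.
  + by apply: continuous_comp; [exact: ch|exact: ck].
  + by rewrite pkE phE fK.
  + by rewrite h01.
- apply: (lift_id (h \o k) e1) => [e|e|] /=.
  + by apply: continuous_comp; [exact: ck|exact: ch].
  + by rewrite phE pkE gK.
  + by rewrite k10.
Qed.

End lifting.

Theorem proposition2p16 (R : realType) (G : lieGroupType R)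
    (X : topologicalType) (a : continuous_action G X)
    (X' : topologicalType) (p : X' -> X) :
  polar_space a ->
  universal_covering R p ->
  polar_covering a p.
Proof.
move=> [fa [_ _ lX _] _ _] [covp scX'].
have [[[e0 _] _] _] := scX'.
have [_ p_surj _] := covp.
have connX' : connected_space X'.
  by split; [exists e0|exact: path_connected_connected scX'.1].
split=> //.
  split=> // e e' pe.
  have cid : continuous (id : X -> X) by move=> ?; exact: cvg_id.
  have [h [hh ph he]] := lift_homeomorphism covp scX' lX cid cid
    (fun=> erefl) (fun=> erefl) (esym pe).
  by exists h.
have ca (g : G) : continuous (a g).
  move=> x; apply: (@continuous_comp _ _ _ (fun x => (g, x))
    (fun gx : G * X => a gx.1 gx.2)).
    by apply: continuous_at_pair; [exact: cvg_cst|exact: cvg_id].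
  exact: act_continuous.
move=> g _; have [e1 _ pe1] := p_surj (a g (p e0)) I.
have [||h [hh ph _]] :=
  lift_homeomorphism covp scX' lX (ca g) (ca g^-1%g) _ _ pe1.
- by move=> x; rewrite -actM mulVg act1.
- by move=> x; rewrite -actM mulgV act1.
have hL : lifted_group a p h by split=> //; exists g.
exists (SigSub (mem_set hL)) => //.
by apply: lifted_group_proj_eq.
Qed.
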